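(* Let $\lambda>0$ and let $$E^{\lambda}(x,t)=g_\lambda(t)\sum_{n=0}^\infty \frac{\left(\lambda+\frac{1-n}{2}+ix\right)_n}{n!}\,t^n ,$$ where $g_\lambda(t)$ is a constant (with respect to $x$) chosen such that $E^{\lambda}(0,t)=1$. Then $$E^{\lambda}(x,t)=\left(\frac t2+\sqrt{1+\frac{t^2}{4}}\right)^{2ix}=\exp\left(2ix\,\operatorname{arcsinh}\left(\frac t2\right)\right).$$
   Context: $x$ is a real variable and $i=\sqrt{-1}$. $(\alpha)_0=1$ and $(\alpha)_n=\alpha(\alpha+1)\cdots(\alpha+n-1)$ is the Pochhammer symbol. The function $E^\lambda(x,t)$ is the analogue of $e^{ixt}$ for the central difference operator $(Tf)(x)=\frac{f(x+i/2)-f(x-i/2)}{i}$. *)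

(* Defs.v *)
From Stdlib Require Import Reals Factorial.
From Coquelicot Require Import Coquelicot.

Open Scope R_scope.
Open Scope C_scope.

Definition Cexp (z : C) : C :=
  (exp (Re z) * cos (Im z), exp (Re z) * sin (Im z))%R.

(* Principal argument, in (-PI, PI]. *)
Definition Carg (z : C) : R :=
  if Rle_dec 0 (Im z) then acos (Re z / Cmod z) else (- acos (Re z / Cmod z))%R.

(* Principal logarithm (only meaningful for z <> 0). *)
Definition Clog (z : C) : C := (ln (Cmod z), Carg z).

(* Principal value of z^w (only meaningful for z <> 0). *)
Definition Cpower (z w : C) : C := Cexp (w * Clog z).

(* Principal square root: the root with positive real part, or with zero real
   part and nonnegative imaginary part. *)
Definition Csqrt (z : C) : C :=
  (sqrt ((Cmod z + Re z) / 2),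
   if Rle_dec 0 (Im z) then sqrt ((Cmod z - Re z) / 2)
   else - sqrt ((Cmod z - Re z) / 2))%R.

Definition Carcsinh (z : C) : C := Clog (z + Csqrt (1 + z * z)).

Fixpoint pochhammer (a : C) (n : nat) : C :=
  match n with
  | O => 1
  | S m => pochhammer a m * (a + INR m)
  end.

Definition E_coef (lambda x : R) (n : nat) : C :=
  pochhammer (lambda + (1 - INR n) / 2 + Ci * x) n / INR (fact n).

Definition E_converges (lambda x : R) (t : C) : Prop :=
  ex_pseries (K := C_AbsRing) (V := C_NormedModule) (E_coef lambda x) t.

(* Since limits in C are unique, [iota] picks the sum of the series whenever
   [E_converges lambda x t]. *)
Definition E_sum (lambda x : R) (t : C) : C :=
  iota (T := C_CompleteNormedModule)
    (is_pseries (K := C_AbsRing) (V := C_NormedModule) (E_coef lambda x) t).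

(* The factor g plays the role of g_lambda: it does not depend on x. *)
Definition E (lambda : R) (g : C -> C) (x : R) (t : C) : C :=
  g t * E_sum lambda x t.

Definition normalizing (lambda : R) (g : C -> C) : Prop :=
  forall t : C, E_converges lambda 0 t -> E lambda g 0 t = 1.

(* Main.v *)
Require Import Defs.
From Stdlib Require Import Reals Factorial Lra Lia.
From Coquelicot Require Import Coquelicot.

(** Put [a = lambda + i x].  The coefficients [a_n] of the series satisfy
    [(n+1) (n+2) a_(n+2) = (a^2 - (n+1)^2/4) a_n], so the sum [F] solves
    [(1 + t^2/4) F'' + 3/4 t F' + (1/4 - a^2) F = 0].  With [t = 2 sinh theta]
    this says that [G = F cosh theta] solves [d^2 G / d theta^2 = 4 a^2 G], and
    the initial values give [F = exp (2 a theta) / cosh theta].  Dividing by the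
    value at [x = 0] leaves [exp (2 i x theta)].

    To stay within real analysis, the equation is solved along the rays [r t],
    [0 <= r < 1], with [t] a point where the series converges; Abel's theorem
    then gives the value at [r = 1], and it also excludes convergence on the
    branch cuts [t = i v], [|v| >= 2]. *)

Open Scope R_scope.
Open Scope C_scope.

(** * Complex-valued functions of a real variable *)

Lemma Cmult_eq_reg_l (z z1 z2 : C) : z * z1 = z * z2 -> z <> 0 -> z1 = z2.
Proof.
intros H Hz.
transitivity (/ z * (z * z1)); [field; exact Hz | rewrite H; field; exact Hz].
Qed.

Lemma Cmult_eq_reg_r (z z1 z2 : C) : z1 * z = z2 * z -> z <> 0 -> z1 = z2.
Proof. rewrite !(Cmult_comm _ z); apply Cmult_eq_reg_l. Qed.

(** Derivatives are taken componentwise, so that the differentiation rules and the mean value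
    argument for real functions apply to each component. *)
Definition is_Cderive (f : R -> C) (r : R) (l : C) : Prop :=
  is_derive (fun x => Re (f x)) r (Re l) /\ is_derive (fun x => Im (f x)) r (Im l).

Lemma is_Cderive_ext_loc (f g : R -> C) (r : R) (l : C) :
  locally r (fun x => f x = g x) -> is_Cderive f r l -> is_Cderive g r l.
Proof.
intros H [H1 H2]; split;
  [eapply is_derive_ext_loc, H1 | eapply is_derive_ext_loc, H2];
  revert H; apply filter_imp; intros x ->; reflexivity.
Qed.

Lemma is_Cderive_ext (f g : R -> C) (r : R) (l : C) :
  (forall x, f x = g x) -> is_Cderive f r l -> is_Cderive g r l.
Proof. intros H; apply is_Cderive_ext_loc; now apply filter_forall. Qed.

Lemma is_Cderive_unique (f : R -> C) (r : R) (l1 l2 : C) :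
  is_Cderive f r l1 -> is_Cderive f r l2 -> l1 = l2.
Proof.
intros [A1 B1] [A2 B2].
apply is_derive_unique in A1, A2, B1, B2.
rewrite A1 in A2; rewrite B1 in B2.
destruct l1, l2; simpl in *; now subst.
Qed.

Lemma is_Cderive_const (c : C) (r : R) : is_Cderive (fun _ => c) r 0.
Proof.
split; [exact (is_derive_const (V := R_NormedModule) (Re c) r) |
  exact (is_derive_const (V := R_NormedModule) (Im c) r)].
Qed.

Lemma is_Cderive_RtoC (r : R) : is_Cderive RtoC r 1.
Proof.
split; [exact (is_derive_id (K := R_AbsRing) r) |
  exact (is_derive_const (V := R_NormedModule) 0%R r)].
Qed.

Lemma is_Cderive_plus (f g : R -> C) (r : R) (df dg : C) :
  is_Cderive f r df -> is_Cderive g r dg ->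
  is_Cderive (fun x => f x + g x) r (df + dg).
Proof.
intros [A1 B1] [A2 B2]; split; simpl.
- apply (is_derive_plus (fun x => Re (f x)) (fun x => Re (g x))); assumption.
- apply (is_derive_plus (fun x => Im (f x)) (fun x => Im (g x))); assumption.
Qed.

Lemma is_Cderive_mult (f g : R -> C) (r : R) (df dg : C) :
  is_Cderive f r df -> is_Cderive g r dg ->
  is_Cderive (fun x => f x * g x) r (df * g r + f r * dg).
Proof.
intros [A1 B1] [A2 B2].
pose proof (fun u v du dv hu hv => is_derive_mult (K := R_AbsRing) u v r du dv hu hv Rmult_comm) as M.
split; simpl.
- replace (_ + _)%R with
    ((Re df * Re (g r) + Re (f r) * Re dg) - (Im df * Im (g r) + Im (f r) * Im dg))%R
    by (unfold Re, Im; ring).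
  apply @is_derive_minus.
  + exact (M _ _ _ _ A1 A2).
  + exact (M _ _ _ _ B1 B2).
- replace (_ + _)%R with
    ((Re df * Im (g r) + Re (f r) * Im dg) + (Im df * Re (g r) + Im (f r) * Re dg))%R
    by (unfold Re, Im; ring).
  apply @is_derive_plus.
  + exact (M _ _ _ _ A1 B2).
  + exact (M _ _ _ _ B1 A2).
Qed.

Lemma is_Cderive_Cexp (f : R -> C) (r : R) (df : C) :
  is_Cderive f r df -> is_Cderive (fun x => Cexp (f x)) r (Cexp (f r) * df).
Proof.
intros [A B].
(* The real and imaginary parts are abstracted to real functions [u] and [v], which [auto_derive]
   can treat as opaque. *)
assert (K : forall (u v : R -> R) (du dv : R), is_derive u r du -> is_derive v r dv ->
  is_derive (fun x => exp (u x) * cos (v x))%R r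
    (exp (u r) * cos (v r) * du - exp (u r) * sin (v r) * dv)%R /\
  is_derive (fun x => exp (u x) * sin (v x))%R r
    (exp (u r) * cos (v r) * dv + exp (u r) * sin (v r) * du)%R).
{ intros u v du dv U V.
  assert (EU : ex_derive u r) by now exists du.
  assert (EV : ex_derive v r) by now exists dv.
  apply is_derive_unique in U, V; rewrite <- U, <- V.
  split; auto_derive; auto; change (Derive (fun x => u x) r) with (Derive u r);
    change (Derive (fun x => v x) r) with (Derive v r); ring. }
destruct (K _ _ _ _ A B) as [K1 K2].
split.
- replace (Re (Cexp (f r) * df)) with
    (exp (Re (f r)) * cos (Im (f r)) * Re df - exp (Re (f r)) * sin (Im (f r)) * Im df)%R
    by reflexivity.
  exact K1.
- replace (Im (Cexp (f r) * df)) with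
    (exp (Re (f r)) * cos (Im (f r)) * Im df + exp (Re (f r)) * sin (Im (f r)) * Re df)%R
    by reflexivity.
  exact K2.
Qed.

(** The endpoints come in either order because the ray parameter is also allowed to be negative. *)
Lemma is_Cderive_zero_const (f : R -> C) (a b : R) :
  (forall x, (Rmin a b <= x <= Rmax a b)%R -> is_Cderive f x 0) -> f a = f b.
Proof.
intros H.
assert (K : forall p q, (p <= q)%R -> (forall x, (p <= x <= q)%R -> is_Cderive f x 0) -> f p = f q).
{ intros p q [Hpq | ->] Hx; [|reflexivity].
  apply injective_projections.
  - apply (eq_is_derive (fun x => Re (f x)) p q); [intros x Hx'; apply (Hx x Hx') | exact Hpq].
  - apply (eq_is_derive (fun x => Im (f x)) p q); [intros x Hx'; apply (Hx x Hx') | exact Hpq]. }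
destruct (Rle_dec a b) as [Hab | Hab].
- apply K; [exact Hab | intros x Hx; apply H].
  rewrite Rmin_left, Rmax_right; assumption.
- symmetry; apply K; [lra | intros x Hx; apply H].
  rewrite Rmin_right, Rmax_left; lra.
Qed.

(** * Complex exponential, principal square root and logarithm *)

Lemma Cexp_plus (z w : C) : Cexp (z + w) = Cexp z * Cexp w.
Proof.
unfold Cexp, Cmult; simpl; rewrite exp_plus, cos_plus, sin_plus.
apply injective_projections; simpl; unfold Re, Im; ring.
Qed.

Lemma Cexp_0 : Cexp 0 = 1.
Proof.
unfold Cexp; simpl; rewrite exp_0, cos_0, sin_0; unfold RtoC.
apply injective_projections; simpl; ring.
Qed.

Lemma Cexp_opp_l (z : C) : Cexp (- z) * Cexp z = 1.
Proof. rewrite <- Cexp_plus, <- Cexp_0; f_equal; ring. Qed.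

Lemma Cexp_neq_0 (z : C) : Cexp z <> 0.
Proof.
intros H; pose proof (Cexp_opp_l z) as K; rewrite H in K.
apply C1_nz; rewrite <- K; ring.
Qed.

Lemma Cmod_Cexp (z : C) : Cmod (Cexp z) = exp (Re z).
Proof.
unfold Cmod, Cexp; simpl fst; simpl snd.
replace (_ + _)%R with (Rsqr (exp (Re z)))%R.
- apply sqrt_Rsqr, Rlt_le, exp_pos.
- pose proof (sin2_cos2 (Im z)) as K; unfold Rsqr in *.
  transitivity (exp (Re z) * exp (Re z) * (sin (Im z) * sin (Im z) + cos (Im z) * cos (Im z)))%R;
    [rewrite K|]; ring.
Qed.

(* The slit plane: the complement of the branch cut (-oo, 0] of the principal
   square root and logarithm. *)
Definition slit (z : C) : Prop := (0 < Cmod z + Re z)%R.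

Lemma Cmod_sq (z : C) : (Cmod z * Cmod z = Re z * Re z + Im z * Im z)%R.
Proof. pose proof (Cmod2_alt z); simpl in *; lra. Qed.

(** Since [|z|^2 - (Re z)^2 = (Im z)^2], the two real roots multiply to [|Im z| / 2]; the sign
    chosen in [Csqrt] turns this into [Im z / 2]. *)
Lemma Csqrt_sq (z : C) : Csqrt z * Csqrt z = z.
Proof.
pose proof (re_le_Cmod z) as K.
assert (K1 : (0 <= (Cmod z + Re z) / 2)%R).
{ pose proof (Rle_abs (- Re z)); rewrite Rabs_Ropp in *; lra. }
assert (K2 : (0 <= (Cmod z - Re z) / 2)%R).
{ pose proof (Rle_abs (Re z)); lra. }
pose proof (sqrt_sqrt _ K1) as S1; pose proof (sqrt_sqrt _ K2) as S2.
assert (S3 : (sqrt ((Cmod z + Re z) / 2) * sqrt ((Cmod z - Re z) / 2) = Rabs (Im z) / 2)%R).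
{ rewrite <- sqrt_mult by assumption.
  replace (_ * _)%R with (Rsqr (Im z / 2)).
  - rewrite sqrt_Rsqr_abs. unfold Rdiv. rewrite Rabs_mult, (Rabs_right (/ 2)); lra.
  - pose proof (Cmod_sq z); unfold Rsqr; lra. }
unfold Csqrt, Cmult; simpl.
apply injective_projections; simpl; destruct (Rle_dec 0 (Im z)) as [H|H].
- unfold Re in *; lra.
- unfold Re in *; lra.
- rewrite Rabs_right in S3 by lra; unfold Im in *; lra.
- rewrite Rabs_left in S3 by lra; unfold Im in *; lra.
Qed.

(** The imaginary part of [Csqrt z * Csqrt z = z] gives the quotient. It is free of the case
    distinction in [Csqrt], hence suitable for differentiation across the positive real axis. *)
Lemma Csqrt_slit (z : C) : slit z ->
  (0 < Re (Csqrt z))%R /\ Im (Csqrt z) = (Im z / (2 * Re (Csqrt z)))%R.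
Proof.
intros H.
assert (P : (0 < Re (Csqrt z))%R) by (simpl; apply sqrt_lt_R0; unfold slit in H; lra).
split; [exact P|].
pose proof (f_equal snd (Csqrt_sq z)) as E; simpl snd at 1 in E.
change (Re (Csqrt z) * Im (Csqrt z) + Im (Csqrt z) * Re (Csqrt z) = Im z)%R in E.
rewrite <- E; field; lra.
Qed.

Lemma slit_Cmod_pos (z : C) : slit z -> (0 < Cmod z)%R.
Proof. unfold slit; intros H; pose proof (re_le_Cmod z); pose proof (Rle_abs (Re z)); lra. Qed.


(** The slit plane is open: [Cmod z + Re z] is continuous, indeed differentiable along the path away
    from zero. *)
Lemma slit_locally (z : R -> C) (r : R) (l : C) :
  is_Cderive z r l -> slit (z r) -> locally r (fun x => slit (z x)).
Proof.
intros [A B] H; pose proof (slit_Cmod_pos _ H) as Hm; unfold slit in *.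
assert (K : forall u v : R -> R, ex_derive u r -> ex_derive v r ->
  (0 < u r * u r + v r * v r)%R ->
  ex_derive (fun x => sqrt (u x * u x + v x * v x) + u x)%R r).
{ intros u v U V P; auto_derive; repeat split; auto. }
assert (C1 : continuous (fun x => Cmod (z x) + Re (z x))%R r).
{ apply (ex_derive_continuous (V := R_NormedModule)).
  eapply ex_derive_ext, (K (fun x => Re (z x)) (fun x => Im (z x))).
  - intros x; simpl; rewrite <- Cmod_sq, sqrt_square by apply Cmod_ge_0; reflexivity.
  - eexists; exact A.
  - eexists; exact B.
  - rewrite <- Cmod_sq; nra. }
apply (C1 (fun y => (0 < y)%R)).
apply (open_gt 0%R), H.
Qed.

(** Existence suffices here: the value of the derivative follows later from differentiating the
    square. *)
Lemma ex_Cderive_Csqrt (z : R -> C) (r : R) (dz : C) :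
  is_Cderive z r dz -> slit (z r) -> exists l, is_Cderive (fun x => Csqrt (z x)) r l.
Proof.
intros D H; destruct (D) as [A B].
assert (EA : ex_derive (fun x => Re (z x)) r) by (eexists; exact A).
assert (EB : ex_derive (fun x => Im (z x)) r) by (eexists; exact B).
pose proof (slit_Cmod_pos _ H) as Hm.
assert (Hs : (0 < Re (z r) * Re (z r) + Im (z r) * Im (z r))%R) by (rewrite <- Cmod_sq; nra).
assert (E1 : ex_derive (fun x => Re (Csqrt (z x))) r).
{ assert (K : forall u v : R -> R, ex_derive u r -> ex_derive v r ->
    (0 < u r * u r + v r * v r)%R -> (0 < sqrt (u r * u r + v r * v r) + u r)%R ->
    ex_derive (fun x => sqrt ((sqrt (u x * u x + v x * v x) + u x) / 2)) r).
  { intros u v U V H1 H2; auto_derive; repeat split; auto; lra. }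
  eapply ex_derive_ext, (K _ _ EA EB Hs).
  - intros x; simpl; rewrite <- Cmod_sq, sqrt_square by apply Cmod_ge_0; reflexivity.
  - rewrite <- Cmod_sq, sqrt_square by apply Cmod_ge_0; exact H. }
assert (E2 : ex_derive (fun x => Im (Csqrt (z x))) r).
{ eapply (ex_derive_ext_loc (fun x => Im (z x) / (2 * Re (Csqrt (z x))))%R).
  { pose proof (slit_locally z r dz D H) as L; revert L; apply filter_imp; intros x Hx.
    symmetry; apply (Csqrt_slit _ Hx). }
  pose proof (proj1 (Csqrt_slit _ H)).
  apply ex_derive_mult; [exact EB|].
  apply ex_derive_inv; [|lra].
  apply ex_derive_mult; [apply ex_derive_const | exact E1]. }
destruct E1 as [l1 E1], E2 as [l2 E2]; exists (l1, l2); split; assumption.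
Qed.

(** In the right half-plane [atan (Im w / Re w)] is a smooth formula for the argument; its cosine is
    [Re w / |w|], and the sign of [Im w] decides how [acos] inverts it. *)
Lemma Clog_right (w : C) : (0 < Re w)%R -> Clog w = (ln (Cmod w), atan (Im w / Re w)).
Proof.
intros H; unfold Clog; f_equal; unfold Carg.
set (q := (Im w / Re w)%R).
assert (Hc : (cos (atan q) = Re w / Cmod w)%R).
{ rewrite cos_atan.
  replace (sqrt (1 + q²)) with (Cmod w / Re w)%R; [field; split; try lra|].
  - pose proof (re_le_Cmod w); pose proof (Rle_abs (Re w)); lra.
  - symmetry; apply sqrt_lem_1.
    + pose proof (Rle_0_sqr q); lra.
    + apply Rmult_le_pos; [apply Cmod_ge_0 | left; now apply Rinv_0_lt_compat].
    + unfold q, Rsqr; pose proof (Cmod_sq w) as K.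
      apply (Rmult_eq_reg_r (Re w * Re w)); [|nra].
      field_simplify; lra. }
pose proof (atan_bound q) as Hb; pose proof PI_RGT_0.
rewrite <- Hc.
destruct (Rle_dec 0 (Im w)) as [Hi|Hi].
- assert (0 <= atan q)%R.
  { rewrite <- atan_0. destruct (Rle_lt_or_eq_dec 0 (Im w) Hi) as [Hi'|Hi'].
    - left; apply atan_increasing; unfold q; apply Rdiv_lt_0_compat; assumption.
    - unfold q; rewrite <- Hi'. right; f_equal; field; lra. }
  apply acos_cos; lra.
- assert (atan q < 0)%R.
  { rewrite <- atan_0; apply atan_increasing; unfold q.
    apply Ropp_lt_cancel; rewrite Ropp_0; replace (- (Im w / Re w))%R with (- Im w / Re w)%R by (field; lra).
    apply Rdiv_lt_0_compat; lra. }
  rewrite <- cos_neg, acos_cos; lra.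
Qed.

Lemma Cexp_Clog (w : C) : (0 < Re w)%R -> Cexp (Clog w) = w.
Proof.
intros H; rewrite Clog_right by exact H.
assert (Hm : (0 < Cmod w)%R) by (pose proof (re_le_Cmod w); pose proof (Rle_abs (Re w)); lra).
unfold Cexp; simpl; rewrite exp_ln by exact Hm.
rewrite cos_atan, sin_atan.
replace (sqrt (1 + (Im w / Re w)²)) with (Cmod w / Re w)%R.
- apply injective_projections; simpl; unfold Re, Im in *; field; split; lra.
- symmetry; apply sqrt_lem_1.
  + pose proof (Rle_0_sqr (Im w / Re w)); lra.
  + apply Rmult_le_pos; [lra | left; now apply Rinv_0_lt_compat].
  + unfold Rsqr; pose proof (Cmod_sq w) as K.
    apply (Rmult_eq_reg_r (Re w * Re w)); [|nra].
    field_simplify; lra.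
Qed.

(** Again only existence; the value follows later from [Cexp (Clog w) = w]. *)
Lemma ex_Cderive_Clog (w : R -> C) (r : R) (dw : C) :
  is_Cderive w r dw -> (0 < Re (w r))%R -> exists l, is_Cderive (fun x => Clog (w x)) r l.
Proof.
intros [A B] H.
assert (EA : ex_derive (fun x => Re (w x)) r) by (eexists; exact A).
assert (EB : ex_derive (fun x => Im (w x)) r) by (eexists; exact B).
assert (Hs : (0 < Re (w r) * Re (w r) + Im (w r) * Im (w r))%R) by nra.
assert (K : forall u v : R -> R, ex_derive u r -> ex_derive v r ->
  (0 < u r)%R -> (0 < u r * u r + v r * v r)%R ->
  ex_derive (fun x => ln (sqrt (u x * u x + v x * v x))) r /\
  ex_derive (fun x => atan (v x / u x)) r).
{ intros u v U V H1 H2; split; auto_derive; repeat split; auto; try lra.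
  now apply sqrt_lt_R0. }
destruct (K _ _ EA EB H Hs) as [[l1 E1] [l2 E2]]; exists (l1, l2).
assert (L : locally r (fun x => (0 < Re (w x))%R)).
{ assert (CA : continuous (fun x => Re (w x)) r) by (apply (ex_derive_continuous (V := R_NormedModule)); exact EA).
  apply (CA (fun y => (0 < y)%R)), (open_gt 0%R), H. }
apply (is_Cderive_ext_loc
  (fun x => (ln (sqrt (Re (w x) * Re (w x) + Im (w x) * Im (w x))), atan (Im (w x) / Re (w x))))).
- revert L; apply filter_imp; intros x Hx; rewrite Clog_right by exact Hx.
  f_equal; f_equal; unfold Cmod; f_equal; simpl; unfold Re, Im; ring.
- split; assumption.
Qed.

(** * Power series with complex coefficients on the real line *)

(** The variable is real and only the coefficients are complex, so the theory of real power series
    applies to each component. *)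
Definition is_CPS (c : nat -> C) (r : R) (l : C) : Prop :=
  is_pseries (fun n => Re (c n)) r (Re l) /\ is_pseries (fun n => Im (c n)) r (Im l).

Definition CPS (c : nat -> C) (r : R) : C :=
  (PSeries (fun n => Re (c n)) r, PSeries (fun n => Im (c n)) r).

Definition CPS_radius_ge_1 (c : nat -> C) : Prop :=
  Rbar_le 1 (CV_radius (fun n => Re (c n))) /\ Rbar_le 1 (CV_radius (fun n => Im (c n))).

Definition CPS_derive (c : nat -> C) (n : nat) : C := INR (S n) * c (S n).

Lemma is_CPS_unique (c : nat -> C) (r : R) (l : C) : is_CPS c r l -> CPS c r = l.
Proof.
intros [A B]; apply is_pseries_unique in A, B; unfold CPS; rewrite A, B.
now destruct l.
Qed.

Lemma is_CPS_ext (c d : nat -> C) (r : R) (l : C) :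
  (forall n, c n = d n) -> is_CPS c r l -> is_CPS d r l.
Proof.
intros H [A B]; split; [eapply is_pseries_ext, A | eapply is_pseries_ext, B];
  intros n; simpl; now rewrite H.
Qed.

Lemma is_CPS_plus (c d : nat -> C) (r : R) (l m : C) :
  is_CPS c r l -> is_CPS d r m -> is_CPS (fun n => c n + d n) r (l + m).
Proof.
intros [A1 B1] [A2 B2]; split.
- exact (is_pseries_plus _ _ _ _ _ A1 A2).
- exact (is_pseries_plus _ _ _ _ _ B1 B2).
Qed.

Lemma is_CPS_scal (k : C) (c : nat -> C) (r : R) (l : C) :
  is_CPS c r l -> is_CPS (fun n => k * c n) r (k * l).
Proof.
intros [A B].
assert (S : forall (q : R) (a : nat -> R) (m : R), is_pseries a r m ->
  is_pseries (fun n => q * a n)%R r (q * m)%R).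
{ intros q a m H; apply (is_pseries_scal q a r m); [apply Rmult_comm | exact H]. }
split.
- exact (is_pseries_minus _ _ _ _ _ (S (Re k) _ _ A) (S (Im k) _ _ B)).
- exact (is_pseries_plus _ _ _ _ _ (S (Re k) _ _ B) (S (Im k) _ _ A)).
Qed.

Definition CPS_shift (c : nat -> C) (n : nat) : C :=
  match n with O => 0 | S m => c m end.

Lemma is_CPS_shift (c : nat -> C) (r : R) (l : C) :
  is_CPS c r l -> is_CPS (CPS_shift c) r (r * l).
Proof.
intros [A B]; split.
- replace (Re (r * l)) with (r * Re l)%R by (unfold Re; simpl; ring).
  eapply is_pseries_ext, (is_pseries_incr_1 _ _ _ A); intros [|n]; reflexivity.
- replace (Im (r * l)) with (r * Im l)%R by (unfold Im; simpl; ring).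
  eapply is_pseries_ext, (is_pseries_incr_1 _ _ _ B); intros [|n]; reflexivity.
Qed.

Lemma CPS_derive_Re (c : nat -> C) (n : nat) :
  PS_derive (fun k => Re (c k)) n = Re (CPS_derive c n).
Proof. unfold PS_derive, CPS_derive, Re, RtoC, Cmult; cbn [fst snd]; ring. Qed.

Lemma CPS_derive_Im (c : nat -> C) (n : nat) :
  PS_derive (fun k => Im (c k)) n = Im (CPS_derive c n).
Proof. unfold PS_derive, CPS_derive, Im, RtoC, Cmult; cbn [fst snd]; ring. Qed.

Lemma CPS_radius_derive (c : nat -> C) :
  CPS_radius_ge_1 c -> CPS_radius_ge_1 (CPS_derive c).
Proof.
intros [A B]; split.
- rewrite <- (CV_radius_ext _ _ (CPS_derive_Re c)), CV_radius_derive; exact A.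
- rewrite <- (CV_radius_ext _ _ (CPS_derive_Im c)), CV_radius_derive; exact B.
Qed.

Lemma CPS_correct (c : nat -> C) (r : R) :
  CPS_radius_ge_1 c -> (Rabs r < 1)%R -> is_CPS c r (CPS c r).
Proof.
intros [A B] H; split; simpl; apply PSeries_correct, CV_radius_inside.
- exact (Rbar_lt_le_trans (Rabs r) 1 _ H A).
- exact (Rbar_lt_le_trans (Rabs r) 1 _ H B).
Qed.

Lemma is_Cderive_CPS (c : nat -> C) (r : R) :
  CPS_radius_ge_1 c -> (Rabs r < 1)%R -> is_Cderive (CPS c) r (CPS (CPS_derive c) r).
Proof.
intros [A B] H; split.
- replace (Re (CPS (CPS_derive c) r)) with (PSeries (PS_derive (fun n => Re (c n))) r)
    by exact (PSeries_ext _ _ r (CPS_derive_Re c)).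
  apply is_derive_PSeries. exact (Rbar_lt_le_trans (Rabs r) 1 _ H A).
- replace (Im (CPS (CPS_derive c) r)) with (PSeries (PS_derive (fun n => Im (c n))) r)
    by exact (PSeries_ext _ _ r (CPS_derive_Im c)).
  apply is_derive_PSeries. exact (Rbar_lt_le_trans (Rabs r) 1 _ H B).
Qed.

Lemma CPS_0 (c : nat -> C) : CPS c 0 = c O.
Proof.
unfold CPS; rewrite !PSeries_0; now destruct (c O).
Qed.

(** Outside the disk of convergence the terms do not tend to zero. *)
Lemma CV_radius_ge_1 (a : nat -> R) : ex_pseries a 1 -> Rbar_le 1 (CV_radius a).
Proof.
intros H; apply Rbar_not_lt_le; intros K.
apply (CV_disk_outside a 1).
- rewrite Rabs_R1; exact K.
- apply ex_series_lim_0, ex_pseries_R, H.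
Qed.

(* Abel's theorem when [rho = 1] is the radius of convergence. *)
Lemma PSeries_at_left (a : nat -> R) (rho : R) :
  ex_pseries a 1 -> (0 < rho <= 1)%R ->
  filterlim (PSeries a) (at_left rho) (locally (PSeries a rho)).
Proof.
intros H Hr; pose proof (CV_radius_ge_1 a H) as K.
destruct (Rbar_lt_dec rho (CV_radius a)) as [L|L].
- eapply filterlim_filter_le_1.
  2: apply continuity_pt_filterlim, PSeries_continuity; rewrite Rabs_right by lra; exact L.
  apply filter_le_within.
- apply Rbar_not_lt_le in L.
  assert (E : CV_radius a = 1%R).
  { apply Rbar_le_antisym; [|exact K].
    eapply Rbar_le_trans; [exact L|]; simpl; lra. }
  assert (rho = 1%R) as -> by (rewrite E in L; simpl in L; lra).
  replace 1%R with (real (CV_radius a)) by now rewrite E.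
  apply Abel; rewrite E; simpl; try lra; trivial.
Qed.

(** Comparison of coefficients: by the recurrence the coefficient of [r^n] on the left is zero. It
    is used with [k = t^2] and [b = a^2]. *)
Lemma CPS_ODE (c : nat -> C) (k b : C) (r : R) :
  CPS_radius_ge_1 c -> (Rabs r < 1)%R ->
  (forall n, CPS_derive (CPS_derive c) n = k * (b - (INR n + 1)^2 / 4) * c n) ->
  (1 + k / 4 * (r * r)) * CPS (CPS_derive (CPS_derive c)) r
  + 3 * k / 4 * (r * CPS (CPS_derive c) r) + k * (1 / 4 - b) * CPS c r = 0.
Proof.
intros Hc Hr Hrec.
pose proof (CPS_correct _ _ Hc Hr) as Y0.
pose proof (CPS_correct _ _ (CPS_radius_derive _ Hc) Hr) as Y1.
pose proof (CPS_correct _ _ (CPS_radius_derive _ (CPS_radius_derive _ Hc)) Hr) as Y2.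
set (y2 := CPS (CPS_derive (CPS_derive c)) r) in *.
set (y1 := CPS (CPS_derive c) r) in *.
set (y0 := CPS c r) in *.
pose proof (is_CPS_plus _ _ _ _ _ Y2
  (is_CPS_plus _ _ _ _ _ (is_CPS_scal (k / 4) _ _ _ (is_CPS_shift _ _ _ (is_CPS_shift _ _ _ Y2)))
  (is_CPS_plus _ _ _ _ _ (is_CPS_scal (3 * k / 4) _ _ _ (is_CPS_shift _ _ _ Y1))
    (is_CPS_scal (k * (1 / 4 - b)) _ _ _ Y0)))) as S.
transitivity (CPS (fun _ => 0) r).
- symmetry; apply is_CPS_unique.
  match goal with |- is_CPS _ _ ?l => match type of S with is_CPS _ _ ?m =>
    replace l with m by (field) end end.
  eapply is_CPS_ext, S; intros n; cbv beta.
  (* The double shift has separate values at the indices 0 and 1. *)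
  rewrite Hrec; destruct n as [|[|n]]; simpl CPS_shift; unfold CPS_derive; rewrite ?S_INR, ?RtoC_plus;
    simpl INR; field.
- unfold CPS; simpl; rewrite PSeries_const_0; reflexivity.
Qed.

(** * The differential equation along a ray *)

(** For [t = 2 sinh theta] this is [cosh theta], and [exp_branch t] is [exp theta]. *)
Definition root_branch (t : C) : C := Csqrt (1 + t ^ 2 / 4).
Definition exp_branch (t : C) : C := t / 2 + root_branch t.

Lemma root_branch_sq (t : C) : root_branch t * root_branch t = 1 + t ^ 2 / 4.
Proof. apply Csqrt_sq. Qed.

Lemma root_branch_Re_pos (t : C) : slit (1 + t ^ 2 / 4) -> (0 < Re (root_branch t))%R.
Proof. intros H; apply (Csqrt_slit _ H). Qed.

Lemma Re_pos_neq_0 (z : C) : (0 < Re z)%R -> z <> 0.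
Proof. intros H ->; simpl in H; lra. Qed.

(* [exp_branch t] and [root_branch t - t / 2] are mutually inverse, so their real
   parts have the same sign, and these add up to [2 * Re (root_branch t)]. *)
Lemma exp_branch_Re_pos (t : C) : slit (1 + t ^ 2 / 4) -> (0 < Re (exp_branch t))%R.
Proof.
intros H; pose proof (root_branch_Re_pos t H) as P.
assert (E : exp_branch t * (root_branch t - t / 2) = 1).
{ unfold exp_branch; transitivity (root_branch t * root_branch t - t ^ 2 / 4).
  - field.
  - rewrite root_branch_sq; ring. }
assert (S : (Re (exp_branch t) + Re (root_branch t - t / 2) = 2 * Re (root_branch t))%R).
{ unfold exp_branch, Re; simpl; ring. }
revert E S; generalize (exp_branch t), (root_branch t - t / 2).
intros [p q] [u v] E S; unfold Re in *; simpl in *.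
injection E as E1 E2.
destruct (Rlt_le_dec 0 p) as [L|L]; [exact L|exfalso].
assert (U : (0 < u)%R) by lra.
assert (V : (q * v <= -1)%R) by nra.
assert (Q : (q * q * u = - p * (q * v))%R) by nra.
assert (q <> 0%R) by (intros ->; lra).
assert (0 < q * q)%R by nra.
nra.
Qed.

Lemma is_Cderive_radial (t : C) (r : R) :
  is_Cderive (fun x => 1 + (x * t) ^ 2 / 4) r (r * t ^ 2 / 2).
Proof.
apply (is_Cderive_ext (fun x => 1 + t ^ 2 / 4 * (x * x))).
{ intros x; field. }
replace (r * t ^ 2 / 2) with (0 + (0 * (r * r) + t ^ 2 / 4 * (1 * r + r * 1)))
  by (field).
apply is_Cderive_plus; [apply is_Cderive_const|].
apply is_Cderive_mult; [apply is_Cderive_const|].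
apply is_Cderive_mult; apply is_Cderive_RtoC.
Qed.

(** Differentiating [s^2 = 1 + (r t)^2 / 4] gives [2 s s' = r t^2 / 2]; the product form avoids a
    division by [s]. *)
Lemma is_Cderive_root_branch (t : C) (r : R) :
  slit (1 + (r * t) ^ 2 / 4) ->
  exists ds, is_Cderive (fun x => root_branch (x * t)) r ds /\
    root_branch (r * t) * ds = r * t ^ 2 / 4.
Proof.
intros H.
destruct (ex_Cderive_Csqrt _ _ _ (is_Cderive_radial t r) H) as [ds D].
exists ds; split; [exact D|].
pose proof (is_Cderive_mult _ _ _ _ _ D D) as DD.
assert (E : ds * Csqrt (1 + (r * t) ^ 2 / 4) + Csqrt (1 + (r * t) ^ 2 / 4) * ds = r * t ^ 2 / 2).
{ eapply is_Cderive_unique; [exact DD|].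
  eapply is_Cderive_ext, is_Cderive_radial; intros x; simpl; now rewrite Csqrt_sq. }
unfold root_branch.
replace (Csqrt _ * ds) with ((ds * Csqrt (1 + (r * t) ^ 2 / 4) + Csqrt (1 + (r * t) ^ 2 / 4) * ds) / 2)
  by (field).
rewrite E; field.
Qed.

(** Let [w = exp theta] be the branch at [r t]. Then [w theta' = t / 2 + s'], and multiplying by [s]
    turns the right side into [(t / 2) w], so [s theta' = t / 2]. *)
Lemma is_Cderive_Clog_exp_branch (t : C) (r : R) :
  slit (1 + (r * t) ^ 2 / 4) ->
  exists dl, is_Cderive (fun x => Clog (exp_branch (x * t))) r dl /\
    root_branch (r * t) * dl = t / 2.
Proof.
intros H.
destruct (is_Cderive_root_branch t r H) as [ds [Ds Es]].
assert (Dw : is_Cderive (fun x => exp_branch (x * t)) r (t / 2 + ds)).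
{ apply is_Cderive_plus; [|exact Ds].
  apply (is_Cderive_ext (fun x => t / 2 * x)).
  { intros x; field. }
  replace (t / 2) with (0 * r + t / 2 * 1) at 1 by ring.
  apply is_Cderive_mult; [apply is_Cderive_const | apply is_Cderive_RtoC]. }
pose proof (exp_branch_Re_pos _ H) as P.
destruct (ex_Cderive_Clog _ _ _ Dw P) as [dl Dl].
exists dl; split; [exact Dl|].
assert (L : locally r (fun x => slit (1 + (x * t) ^ 2 / 4)))
  by (eapply (slit_locally (fun x => 1 + (x * t) ^ 2 / 4)), H; apply is_Cderive_radial).
assert (E : Cexp (Clog (exp_branch (r * t))) * dl = t / 2 + ds).
{ eapply is_Cderive_unique, Dw.
  eapply is_Cderive_ext_loc, (is_Cderive_Cexp (fun x => Clog (exp_branch (x * t)))), Dl.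
  revert L; apply filter_imp; intros x Hx; apply Cexp_Clog, exp_branch_Re_pos, Hx. }
rewrite Cexp_Clog in E by exact P.
apply (Cmult_eq_reg_l (exp_branch (r * t))); [|now apply Re_pos_neq_0].
transitivity (root_branch (r * t) * (exp_branch (r * t) * dl)); [ring|rewrite E].
rewrite Cmult_plus_distr_l, Es; unfold exp_branch; field.
Qed.

Lemma Csqrt_1 : Csqrt 1 = 1.
Proof.
unfold Csqrt; rewrite Cmod_1; simpl.
replace ((1 + 1) / 2)%R with 1%R by lra; replace ((1 - 1) / 2)%R with 0%R by lra.
rewrite sqrt_1, sqrt_0; destruct (Rle_dec 0 0); [reflexivity | lra].
Qed.

Lemma root_branch_0 : root_branch 0 = 1.
Proof.
unfold root_branch; replace (1 + 0 ^ 2 / 4) with (RtoC 1) by (field).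
apply Csqrt_1.
Qed.

Lemma Clog_exp_branch_0 : Clog (exp_branch 0) = 0.
Proof.
unfold exp_branch; rewrite root_branch_0.
replace (0 / 2 + 1) with (RtoC 1) by (field).
rewrite Clog_right by (simpl; lra).
rewrite Cmod_1, ln_1; unfold Im, Re; simpl; unfold Rdiv; rewrite Rmult_0_l, atan_0; reflexivity.
Qed.

(* With [theta = Clog (exp_branch (r t))], so [d theta / dr = t / (2 s)], the
   function [G = s y] satisfies [d^2 G / d theta^2 = 4 a^2 G]; the two factors of
   this equation are solved in turn, using the integrating factors
   [exp (2 a theta)] and [exp (- 2 a theta)]. *)
Lemma root_branch_mul_CPS (c : nat -> C) (a t : C) (rho : R) :
  CPS_radius_ge_1 c -> (rho <= 1)%R ->
  (forall n, CPS_derive (CPS_derive c) n = t ^ 2 * (a ^ 2 - (INR n + 1) ^ 2 / 4) * c n) ->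
  c 0%nat = 1 -> c 1%nat = a * t ->
  (forall r : R, (Rabs r < rho)%R -> slit (1 + (r * t) ^ 2 / 4)) ->
  forall r : R, (Rabs r < rho)%R ->
  root_branch (r * t) * CPS c r = Cexp (2 * a * Clog (exp_branch (r * t))).
Proof.
intros Hc Hrho Hrec H0 H1 Hslit r Hr.
set (s := fun x : R => root_branch (x * t)).
set (th := fun x : R => Clog (exp_branch (x * t))).
set (y := CPS c); set (y1 := CPS (CPS_derive c)); set (y2 := CPS (CPS_derive (CPS_derive c))).
(* [D] is [s (s y)'], that is [(t / 2) dG / d theta], written without derivatives of [s] so that
   only [y] has to be differentiated twice. *)
set (D := fun x : R => (1 + (x * t) ^ 2 / 4) * y1 x + t ^ 2 / 4 * x * y x).
(* [H] is [(t / 2) (dG / d theta - 2 a G) exp (2 a theta)], constant and zero at 0 by the initial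
   values; then [K = G exp (- 2 a theta)] is constant and equal to 1. *)
set (H := fun x : R => (D x - a * t * (s x * y x)) * Cexp (2 * a * th x)).
set (K := fun x : R => s x * y x * Cexp (- (2 * a) * th x)).
assert (s0 : s 0%R = 1) by (unfold s; rewrite Cmult_0_l; apply root_branch_0).
assert (th0 : th 0%R = 0) by (unfold th; rewrite Cmult_0_l; apply Clog_exp_branch_0).
assert (y0 : y 0%R = 1) by (unfold y; rewrite CPS_0; exact H0).
assert (y10 : y1 0%R = a * t).
{ unfold y1; rewrite CPS_0; unfold CPS_derive; rewrite H1; simpl; ring. }
assert (Sx : forall x, (Rabs x < rho)%R -> s x <> 0)
  by (intros x Hx; apply Re_pos_neq_0, root_branch_Re_pos, Hslit, Hx).
assert (Dy : forall x, (Rabs x < rho)%R -> is_Cderive y x (y1 x))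
  by (intros x Hx; apply is_Cderive_CPS; [exact Hc | lra]).
assert (Dy1 : forall x, (Rabs x < rho)%R -> is_Cderive y1 x (y2 x))
  by (intros x Hx; apply is_Cderive_CPS; [now apply CPS_radius_derive | lra]).
assert (Ds : forall x, (Rabs x < rho)%R ->
  exists ds, is_Cderive s x ds /\ s x * ds = x * t ^ 2 / 4)
  by (intros x Hx; apply is_Cderive_root_branch, Hslit, Hx).
assert (Dth : forall x, (Rabs x < rho)%R -> exists dl, is_Cderive th x dl /\ s x * dl = t / 2)
  by (intros x Hx; apply is_Cderive_Clog_exp_branch, Hslit, Hx).
assert (ODE : forall x, (Rabs x < rho)%R ->
  (1 + t ^ 2 / 4 * (x * x)) * y2 x + 3 * t ^ 2 / 4 * (x * y1 x)
  + t ^ 2 * (1 / 4 - a ^ 2) * y x = 0)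
  by (intros x Hx; apply CPS_ODE; auto; lra).
assert (DE : forall (b : C) x dl, is_Cderive th x dl ->
  is_Cderive (fun x => Cexp (b * th x)) x (Cexp (b * th x) * (b * dl))).
{ intros b x dl Hx.
  replace (b * dl) with (0 * th x + b * dl) by ring.
  apply (is_Cderive_Cexp (fun x => b * th x)), is_Cderive_mult; [apply is_Cderive_const | exact Hx]. }
assert (DE' : forall x ds, s x * ds = x * t ^ 2 / 4 -> D x = s x * (ds * y x + s x * y1 x)).
{ intros x ds Es; unfold D.
  replace (1 + (x * t) ^ 2 / 4) with (s x * s x) by (apply root_branch_sq).
  replace (t ^ 2 / 4 * x) with (s x * ds) by (rewrite Es; field).
  ring. }
assert (Hconst : forall x, (Rabs x < rho)%R -> forall u, (Rmin 0 x <= u <= Rmax 0 x)%R -> (Rabs u < rho)%R).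
{ intros x Hx u Hu; revert Hu Hx; unfold Rmin, Rmax, Rabs.
  destruct (Rle_dec 0 x), (Rcase_abs x), (Rcase_abs u); lra. }
assert (DH : forall x, (Rabs x < rho)%R -> is_Cderive H x 0).
{ intros x Hx.
  destruct (Ds x Hx) as [ds [Dsx Es]]; destruct (Dth x Hx) as [dl [Dl El]].
  (* This is the differential equation: [D' = t^2 a^2 y]. *)
  assert (DD : is_Cderive D x (t ^ 2 * a ^ 2 * y x)).
  { replace (t ^ 2 * a ^ 2 * y x) with
      ((x * t ^ 2 / 2 * y1 x + (1 + (x * t) ^ 2 / 4) * y2 x) +
       ((0 * x + t ^ 2 / 4 * 1) * y x + t ^ 2 / 4 * x * y1 x)).
    - apply is_Cderive_plus; apply is_Cderive_mult; auto using is_Cderive_radial.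
      apply is_Cderive_mult; [apply is_Cderive_const | apply is_Cderive_RtoC].
    - pose proof (ODE x Hx) as Z.
      match type of Z with ?l = _ => transitivity (t ^ 2 * a ^ 2 * y x + l) end.
      + field.
      + rewrite Z; ring. }
  assert (DG : is_Cderive (fun x => - (a * t) * (s x * y x)) x
     (0 * (s x * y x) + - (a * t) * (ds * y x + s x * y1 x))).
  { repeat apply is_Cderive_mult; auto; apply is_Cderive_const. }
  pose proof (is_Cderive_mult _ _ _ _ _ (is_Cderive_plus _ _ _ _ _ DD DG) (DE (2 * a) x dl Dl)) as DHx.
  match type of DHx with is_Cderive _ _ ?l => replace (RtoC 0) with l end.
  - eapply is_Cderive_ext, DHx; intros u; unfold H; ring.
  - apply (Cmult_eq_reg_l (s x)); [|exact (Sx x Hx)].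
    rewrite (DE' x ds Es).
    (* After multiplication by [s], the derivative of [H] contains the factor [t - 2 s theta'],
       which vanishes. *)
    transitivity ((t - 2 * (s x * dl)) *
      (a ^ 2 * t * s x * y x - a * (s x * (ds * y x + s x * y1 x))) * Cexp (2 * a * th x)); [ring|].
    rewrite El; field. }
assert (HD : forall x, (Rabs x < rho)%R -> D x = a * t * (s x * y x)).
{ intros x Hx.
  assert (Hz : H x = 0).
  { transitivity (H 0%R).
    - symmetry; apply is_Cderive_zero_const; intros u Hu; apply DH, (Hconst x Hx u Hu).
    - unfold H, D; rewrite s0, th0, y0, y10; field. }
  unfold H in Hz.
  assert (Hz' : D x - a * t * (s x * y x) = 0).
  { apply (Cmult_eq_reg_r (Cexp (2 * a * th x))); [|apply Cexp_neq_0].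
    rewrite Hz; ring. }
  rewrite <- (Cplus_0_r (a * t * (s x * y x))), <- Hz'; ring. }
assert (DK : forall x, (Rabs x < rho)%R -> is_Cderive K x 0).
{ intros x Hx.
  destruct (Ds x Hx) as [ds [Dsx Es]]; destruct (Dth x Hx) as [dl [Dl El]].
  pose proof (is_Cderive_mult _ _ _ _ _ (is_Cderive_mult _ _ _ _ _ Dsx (Dy x Hx))
    (DE (- (2 * a)) x dl Dl)) as DKx.
  match type of DKx with is_Cderive _ _ ?l => replace (RtoC 0) with l end; [exact DKx|].
  apply (Cmult_eq_reg_l (s x)); [|exact (Sx x Hx)].
  transitivity ((s x * (ds * y x + s x * y1 x) - 2 * a * (s x * dl) * (s x * y x))
    * Cexp (- (2 * a) * th x)); [ring|].
  (* Here [s G' = D = a t G], and [2 a s theta' G] is the same quantity. *)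
  rewrite <- (DE' x ds Es), (HD x Hx), El; field. }
assert (HK : K r = 1).
{ transitivity (K 0%R).
  - symmetry; apply is_Cderive_zero_const; intros u Hu; apply DK, (Hconst r Hr u Hu).
  - unfold K; rewrite s0, th0, y0, Cmult_0_r, Cexp_0; ring. }
unfold K in HK.
apply (Cmult_eq_reg_r (Cexp (- (2 * a) * th r))); [|apply Cexp_neq_0].
change (s r * y r * Cexp (- (2 * a) * th r) = Cexp (2 * a * th r) * Cexp (- (2 * a) * th r)).
rewrite HK, <- Cexp_plus, <- Cexp_0; f_equal; ring.
Qed.

(** * The limit at the end of the ray *)

(** One-sided, because Abel's theorem gives only the limit from inside the interval of
    convergence. *)
Definition Cleft_continuous (f : R -> C) (rho : R) : Prop :=
  filterlim (fun r => Re (f r)) (at_left rho) (locally (Re (f rho))) /\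
  filterlim (fun r => Im (f r)) (at_left rho) (locally (Im (f rho))).

Lemma filterlim_Rmult_at_left (f g : R -> R) (rho l m : R) :
  filterlim f (at_left rho) (locally l) -> filterlim g (at_left rho) (locally m) ->
  filterlim (fun r => f r * g r)%R (at_left rho) (locally (l * m)%R).
Proof.
intros A B; eapply filterlim_comp_2; [exact A | exact B | exact (filterlim_mult (K := R_AbsRing) l m)].
Qed.

Lemma filterlim_Rplus_at_left (f g : R -> R) (rho l m : R) :
  filterlim f (at_left rho) (locally l) -> filterlim g (at_left rho) (locally m) ->
  filterlim (fun r => f r + g r)%R (at_left rho) (locally (l + m)%R).
Proof.
intros A B; eapply filterlim_comp_2; [exact A | exact B | exact (filterlim_plus (V := R_NormedModule) l m)].
Qed.

Lemma filterlim_at_left_unique (f g : R -> R) (rho l m : R) :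
  (0 < rho)%R -> (forall r, (0 < r < rho)%R -> f r = g r) ->
  filterlim f (at_left rho) (locally l) -> filterlim g (at_left rho) (locally m) -> l = m.
Proof.
intros Hr E A B.
apply (filterlim_locally_unique (K := R_AbsRing) (V := R_NormedModule) (F := at_left rho) g); [|exact B].
eapply filterlim_ext_loc, A.
(* Within distance [rho] to the left of [rho], all points lie in [(0, rho)]. *)
exists (mkposreal rho Hr); intros y Hy Hlt; apply E.
change (Rabs (y - rho) < rho)%R in Hy.
unfold Rabs in Hy; destruct (Rcase_abs (y - rho)); lra.
Qed.

Lemma Cleft_continuous_mult (f g : R -> C) (rho : R) :
  Cleft_continuous f rho -> Cleft_continuous g rho ->
  Cleft_continuous (fun r => f r * g r) rho.
Proof.
intros [A1 B1] [A2 B2].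
assert (N : forall (u : R -> R) l, filterlim u (at_left rho) (locally l) ->
  filterlim (fun r => - u r)%R (at_left rho) (locally (- l)%R)).
{ intros u l Hu; eapply filterlim_comp; [exact Hu | exact (filterlim_opp (V := R_NormedModule) l)]. }
split.
- apply (filterlim_Rplus_at_left (fun r => Re (f r) * Re (g r))%R (fun r => - (Im (f r) * Im (g r)))%R);
    [|apply N]; apply filterlim_Rmult_at_left; assumption.
- apply (filterlim_Rplus_at_left (fun r => Re (f r) * Im (g r))%R (fun r => Im (f r) * Re (g r))%R);
    apply filterlim_Rmult_at_left; assumption.
Qed.

Lemma is_Cderive_Cleft_continuous (f : R -> C) (rho : R) (l : C) :
  is_Cderive f rho l -> Cleft_continuous f rho.
Proof.
intros [A B].
assert (K : forall (u : R -> R) m, is_derive u rho m -> filterlim u (at_left rho) (locally (u rho))).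
{ intros u m Hu.
  assert (Hc : continuous u rho) by (apply (ex_derive_continuous (V := R_NormedModule)); exists m; exact Hu).
  eapply filterlim_filter_le_1; [apply filter_le_within | exact Hc]. }
split; [exact (K _ _ A) | exact (K _ _ B)].
Qed.

Lemma Cleft_continuous_eq (f g : R -> C) (rho : R) :
  (0 < rho)%R -> (forall r, (0 < r < rho)%R -> f r = g r) ->
  Cleft_continuous f rho -> Cleft_continuous g rho -> f rho = g rho.
Proof.
intros Hr E [A1 B1] [A2 B2]; apply injective_projections.
- eapply filterlim_at_left_unique; [exact Hr | | exact A1 | exact A2].
  intros r H; simpl; now rewrite E.
- eapply filterlim_at_left_unique; [exact Hr | | exact B1 | exact B2].
  intros r H; simpl; now rewrite E.
Qed.

Lemma is_CPS_1_radius (c : nat -> C) (l : C) : is_CPS c 1 l -> CPS_radius_ge_1 c.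
Proof. intros [A B]; split; apply CV_radius_ge_1; eexists; eassumption. Qed.

Lemma is_CPS_1_Cleft_continuous (c : nat -> C) (l : C) (rho : R) :
  is_CPS c 1 l -> (0 < rho <= 1)%R -> Cleft_continuous (CPS c) rho.
Proof.
intros [A B] Hr; split; simpl.
- apply (PSeries_at_left (fun n => Re (c n))); [eexists; exact A | exact Hr].
- apply (PSeries_at_left (fun n => Im (c n))); [eexists; exact B | exact Hr].
Qed.

(** * The series of the generating function *)

Lemma pochhammer_S_l (a : C) (n : nat) : pochhammer a (S n) = a * pochhammer (a + 1) n.
Proof.
induction n as [|n IH].
- simpl; ring.
- change (pochhammer a (S (S n))) with (pochhammer a (S n) * (a + INR (S n))).
  rewrite IH, S_INR, RtoC_plus; simpl; ring.
Qed.

Lemma INR_S_neq_0 (n : nat) : RtoC (INR (S n)) <> 0.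
Proof. intros E; apply RtoC_inj in E; revert E; apply not_0_INR; lia. Qed.

Lemma INR_fact_C_neq_0 (n : nat) : RtoC (INR (fact n)) <> 0.
Proof. intros E; apply RtoC_inj in E; exact (INR_fact_neq_0 n E). Qed.

(** From [n] to [n + 2] the base of the Pochhammer symbol drops by 1, so one factor appears at each
    end. With [a = lambda + i x] these are [a - (n + 1) / 2] and [a + (n + 1) / 2]. *)
Lemma E_coef_rec (lambda x : R) (n : nat) :
  INR (S n) * (INR (S (S n)) * E_coef lambda x (S (S n)))
  = ((lambda + Ci * x) ^ 2 - (INR n + 1) ^ 2 / 4) * E_coef lambda x n.
Proof.
unfold E_coef.
set (b := lambda + (1 - INR (S (S n))) / 2 + Ci * x).
change (pochhammer b (S (S n))) with (pochhammer b (S n) * (b + INR (S n))).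
rewrite pochhammer_S_l.
replace (b + 1) with (lambda + (1 - INR n) / 2 + Ci * x).
2: { unfold b; rewrite !S_INR, !RtoC_plus; field. }
change (fact (S (S n))) with (S (S n) * (S n * fact n))%nat.
rewrite !mult_INR, !RtoC_mult.
transitivity (b * (b + INR (S n)) * pochhammer (lambda + (1 - INR n) / 2 + Ci * x) n / INR (fact n)).
{ field; repeat split; try apply INR_S_neq_0; apply INR_fact_C_neq_0. }
replace (b * (b + INR (S n))) with ((lambda + Ci * x) ^ 2 - (INR n + 1) ^ 2 / 4).
{ field; apply INR_fact_C_neq_0. }
unfold b; rewrite !S_INR, !RtoC_plus; field.
Qed.

(** The power of [t] is absorbed into the coefficient: a power series in [r] with these coefficients
    is the original series at [r t], and [r = 1] is the point [t] itself. *)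
Definition E_term (lambda x : R) (t : C) (n : nat) : C := E_coef lambda x n * t ^ n.

Lemma E_term_rec (lambda x : R) (t : C) (n : nat) :
  CPS_derive (CPS_derive (E_term lambda x t)) n
  = t ^ 2 * ((lambda + Ci * x) ^ 2 - (INR n + 1) ^ 2 / 4) * E_term lambda x t n.
Proof.
unfold CPS_derive, E_term.
transitivity (t ^ 2 * t ^ n * (INR (S n) * (INR (S (S n)) * E_coef lambda x (S (S n))))).
- simpl; ring.
- rewrite E_coef_rec; ring.
Qed.

Lemma E_term_0 (lambda x : R) (t : C) : E_term lambda x t 0 = 1.
Proof. unfold E_term, E_coef; simpl; field. Qed.

Lemma E_term_1 (lambda x : R) (t : C) : E_term lambda x t 1 = (lambda + Ci * x) * t.
Proof. unfold E_term, E_coef; simpl; field. Qed.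

Lemma pow_n_Cpow (t : C) (n : nat) : pow_n (K := C_AbsRing) t n = t ^ n.
Proof. induction n as [|n IH]; [reflexivity | simpl; now rewrite IH]. Qed.

Lemma sum_n_C (a : nat -> C) (n : nat) :
  sum_n (G := C_NormedModule) a n =
  (sum_n (fun k => Re (a k)) n, sum_n (fun k => Im (a k)) n) :> C.
Proof.
induction n as [|n IH].
- rewrite !sum_O; now destruct (a O).
- rewrite !sum_Sn, IH; reflexivity.
Qed.

Lemma is_pseries_E_term (lambda x : R) (t l : C) :
  is_pseries (K := C_AbsRing) (V := C_NormedModule) (E_coef lambda x) t l ->
  is_CPS (E_term lambda x t) 1 l.
Proof.
intros H.
assert (H' : filterlim (fun n => (sum_n (fun k => Re (E_term lambda x t k)) n,
    sum_n (fun k => Im (E_term lambda x t k)) n)) eventually (locally (T := C_UniformSpace) l)).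
{ eapply filterlim_ext, H; intros n; rewrite sum_n_C.
  f_equal; apply sum_n_ext; intros k; rewrite pow_n_Cpow;
    unfold E_term; rewrite (Cmult_comm (E_coef _ _ _)); reflexivity. }
assert (P : forall a m, is_series a m -> is_pseries (K := R_AbsRing) (V := R_NormedModule) a 1%R m).
{ intros a m; apply is_series_ext; intros k.
  rewrite pow_n_pow, pow1; symmetry; apply (scal_one (a k)). }
split; apply P.
- intros Q [e He].
  (* Balls in [C] are products of balls, so a neighbourhood of [Re l] pulls back to one of [l]. *)
  destruct (H' (fun z => Q (Re z))) as [N HN].
  + exists e; intros z [Hz _]; apply He, Hz.
  + exists N; exact HN.
- intros Q [e He].
  destruct (H' (fun z => Q (Im z))) as [N HN].
  + exists e; intros z [_ Hz]; apply He, Hz.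
  + exists N; exact HN.
Qed.

Lemma E_sum_correct (lambda x : R) (t : C) :
  E_converges lambda x t -> is_CPS (E_term lambda x t) 1 (E_sum lambda x t).
Proof.
intros [l Hl]; apply is_pseries_E_term; unfold E_sum.
apply (iota_correct (V := C_CompleteNormedModule)
  (is_pseries (K := C_AbsRing) (V := C_NormedModule) (E_coef lambda x) t)).
exists l; split; [exact Hl|].
(* Uniqueness of the sum, required by [iota], comes from the real and imaginary series. *)
intros m Hm; apply is_pseries_E_term, is_CPS_unique in Hl.
apply is_pseries_E_term, is_CPS_unique in Hm; now rewrite <- Hl, <- Hm.
Qed.

(** * The branch cuts and the closed form of the sum *)

Lemma slit_iff (z : C) : slit z <-> ~ (Im z = 0%R /\ (Re z <= 0)%R).
Proof.
unfold slit; pose proof (Cmod_ge_0 z); pose proof (Cmod_sq z) as K; split.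
- intros H1 [H2 H3]; rewrite H2 in K.
  assert (Cmod z = - Re z)%R by nra. lra.
- intros H1; destruct (Rlt_le_dec 0 (Re z)); [lra|].
  assert (Im z <> 0%R) by (intros E; apply H1; split; assumption).
  assert (0 < Im z * Im z)%R by nra. nra.
Qed.

Lemma Re_radial (t : C) (r : R) :
  Re (1 + (r * t) ^ 2 / 4) = (1 + r * r * (Re t * Re t - Im t * Im t) / 4)%R.
Proof. unfold Re, Im; simpl; field. Qed.

Lemma Im_radial (t : C) (r : R) :
  Im (1 + (r * t) ^ 2 / 4) = (r * r * (Re t * Im t) / 2)%R.
Proof. unfold Re, Im; simpl; field. Qed.

(** The slit plane is star-shaped about 1, and [1 + r^2 t^2 / 4] lies on the segment from 1 to
    [1 + t^2 / 4]. *)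
Lemma slit_radial (t : C) (r : R) :
  slit (1 + t ^ 2 / 4) -> (Rabs r <= 1)%R -> slit (1 + (r * t) ^ 2 / 4).
Proof.
rewrite <- (Cmult_1_l t) at 1; rewrite !slit_iff, !Re_radial, !Im_radial.
intros H Hr [H1 H2]; apply H.
assert (r * r <= 1)%R by (unfold Rabs in Hr; destruct (Rcase_abs r); nra).
assert (Hr0 : (r * r <> 0)%R) by (intros E; rewrite E in H2; lra).
assert (0 < r * r)%R by nra.
assert (E : (Re t * Im t = 0)%R) by (apply (Rmult_eq_reg_l (r * r)); [lra | exact Hr0]).
split; [lra | nra].
Qed.

Lemma Csqrt_R (q : R) : (0 <= q)%R -> Csqrt q = sqrt q.
Proof.
intros H; unfold Csqrt; rewrite Cmod_R, Rabs_right by lra; simpl.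
replace ((q + q) / 2)%R with q by lra; replace ((q - q) / 2)%R with 0%R by lra.
rewrite sqrt_0; destruct (Rle_dec 0 0); [reflexivity | lra].
Qed.

(* On the cut [t = i v], [|v| >= 2], one would have
   [|1 + (r t)^2 / 4| |E_sum (r t)|^2 = 1] for [0 < r < 2 / |v|], against Abel's
   theorem at [r = 2 / |v|]. *)
Lemma E_converges_slit (lambda : R) (t : C) :
  E_converges lambda 0 t -> slit (1 + t ^ 2 / 4).
Proof.
intros Hcv; apply E_sum_correct in Hcv.
rewrite <- (Cmult_1_l t); rewrite slit_iff, Re_radial, Im_radial; intros [H1 H2].
set (v := Im t) in *.
assert (V : (4 <= v * v)%R) by nra.
assert (U : Re t = 0%R).
{ apply (Rmult_eq_reg_r v); [lra | intros E; rewrite E in V; lra]. }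
assert (Et : t = (0, v)%R) by (apply injective_projections; [exact U | reflexivity]).
(* The parameter at which the ray meets the branch point, where [1 + (rho t)^2 / 4 = 0]. *)
set (rho := (2 / Rabs v)%R).
assert (Av : (2 <= Rabs v)%R) by (unfold Rabs; destruct (Rcase_abs v); nra).
assert (Avv : (Rabs v * Rabs v = v * v)%R) by (unfold Rabs; destruct (Rcase_abs v); ring).
assert (Hrho : (rho * Rabs v = 2)%R) by (unfold rho; field; lra).
assert (Hrho1 : (0 < rho <= 1)%R) by (split; nra).
assert (Er : (rho * rho * (v * v) = 4)%R) by (rewrite <- Avv; nra).
pose proof (is_CPS_1_radius _ _ Hcv) as Hrad.
assert (Hpos : forall r, (Rabs r < rho)%R -> (0 < 1 - r * r * (v * v) / 4)%R).
{ intros r Hr; assert (r * r < rho * rho)%R by (unfold Rabs in Hr; destruct (Rcase_abs r); nra). nra. }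
assert (Ez : forall r : R, 1 + (r * t) ^ 2 / 4 = (1 - r * r * (v * v) / 4)%R).
{ intros r; apply injective_projections.
  - change (Re (1 + (r * t) ^ 2 / 4) = (1 - r * r * (v * v) / 4)%R).
    rewrite Re_radial, U; fold v; field.
  - change (Im (1 + (r * t) ^ 2 / 4) = 0%R).
    rewrite Im_radial, U; field. }
set (c := E_term lambda 0 t) in *.
(* This is [G^2]: squaring replaces the root, which is not differentiable at the branch point, by a
   polynomial. *)
set (f := fun r : R => (1 + (r * t) ^ 2 / 4) * (CPS c r * CPS c r)).
assert (Hf : forall r, (0 < r < rho)%R -> (Re (f r) * Re (f r) + Im (f r) * Im (f r) = 1)%R).
{ intros r Hr.
  assert (Hr' : (Rabs r < rho)%R) by (rewrite Rabs_right; lra).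
  assert (M : root_branch (r * t) * CPS c r = Cexp (2 * (lambda + Ci * 0) * Clog (exp_branch (r * t)))).
  { apply (root_branch_mul_CPS c _ t rho); try lra; auto.
    - apply E_term_rec.
    - apply E_term_0.
    - apply E_term_1.
    - intros q Hq; rewrite slit_iff, Ez; simpl; intros [_ K]; pose proof (Hpos q Hq); lra. }
  pose proof (Hpos r Hr') as P.
  (* Before the branch point [r t / 2] is imaginary and the root is real, with squared moduli adding
     up to 1. Hence [theta] is imaginary, and as [lambda] is real, [exp (2 lambda theta)] has
     modulus 1. *)
  assert (W : Cmod (exp_branch (r * t)) = 1%R).
  { unfold exp_branch, root_branch; rewrite Ez, Csqrt_R by lra; unfold Cmod.
    transitivity (sqrt 1); [f_equal; rewrite Et; simpl | apply sqrt_1].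
    pose proof (sqrt_sqrt _ (Rlt_le _ _ P)); field_simplify; nra. }
  assert (Cf : Cmod (f r) = 1%R).
  { unfold f; rewrite <- root_branch_sq.
    replace (_ * _) with ((root_branch (r * t) * CPS c r) * (root_branch (r * t) * CPS c r)) by ring.
    rewrite M, Cmod_mult, Cmod_Cexp; unfold Clog; rewrite W, ln_1.
    replace (Re _) with 0%R by (unfold Re, Im; simpl; ring).
    rewrite exp_0; ring. }
  rewrite <- Cmod_sq, Cf; ring. }
assert (L : Cleft_continuous f rho).
{ pose proof (is_CPS_1_Cleft_continuous _ _ _ Hcv Hrho1).
  apply Cleft_continuous_mult; [|now apply Cleft_continuous_mult].
  eapply is_Cderive_Cleft_continuous, is_Cderive_radial. }
assert (F0 : f rho = 0).
{ unfold f; rewrite Ez, Er; replace (1 - 4 / 4)%R with 0%R by field; ring. }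
destruct L as [L1 L2].
assert (K : (Re (f rho) * Re (f rho) + Im (f rho) * Im (f rho) = 1)%R).
{ eapply (filterlim_at_left_unique _ (fun _ => 1%R) rho); [lra | exact Hf | |].
  - apply filterlim_Rplus_at_left; apply filterlim_Rmult_at_left; assumption.
  - apply filterlim_const. }
rewrite F0 in K; simpl in K; lra.
Qed.

(** The identity holds on the ray for [r < 1], and both sides are left continuous at [r = 1]: the
    series by Abel's theorem, the branches because [t] is off the cuts. *)
Lemma E_sum_eq (lambda x : R) (t : C) :
  E_converges lambda x t -> slit (1 + t ^ 2 / 4) ->
  root_branch t * E_sum lambda x t = Cexp (2 * (lambda + Ci * x) * Clog (exp_branch t)).
Proof.
intros Hcv Ht; apply E_sum_correct in Hcv.
set (c := E_term lambda x t) in *.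
assert (S1 : slit (1 + (1 * t) ^ 2 / 4)) by (now rewrite Cmult_1_l).
assert (K : root_branch (1 * t) * CPS c 1 = Cexp (2 * (lambda + Ci * x) * Clog (exp_branch (1 * t)))).
{ apply (Cleft_continuous_eq (fun r : R => root_branch (r * t) * CPS c r)
    (fun r : R => Cexp (2 * (lambda + Ci * x) * Clog (exp_branch (r * t)))) 1 Rlt_0_1).
  - intros r Hr; apply (root_branch_mul_CPS c _ t 1); try lra.
    + exact (is_CPS_1_radius _ _ Hcv).
    + apply E_term_rec.
    + apply E_term_0.
    + apply E_term_1.
    + intros q Hq; apply slit_radial; [exact Ht | lra].
    + rewrite Rabs_right; lra.
  - apply Cleft_continuous_mult.
    + destruct (is_Cderive_root_branch t 1 S1) as [d [D _]].
      eapply is_Cderive_Cleft_continuous, D.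
    + apply (is_CPS_1_Cleft_continuous _ _ _ Hcv); lra.
  - destruct (is_Cderive_Clog_exp_branch t 1 S1) as [d [D _]].
    eapply is_Cderive_Cleft_continuous.
    apply (is_Cderive_Cexp (fun r : R => 2 * (lambda + Ci * x) * Clog (exp_branch (r * t)))).
    apply is_Cderive_mult; [apply is_Cderive_const | exact D]. }
rewrite Cmult_1_l in K; rewrite <- K; f_equal; symmetry; apply is_CPS_unique, Hcv.
Qed.

(** * Convergence in the disk [|t| < 2] *)

Lemma prefix_geometric_bound (u : nat -> R) (q : R) (N : nat) :
  (0 < q)%R -> exists M : R, (0 <= M)%R /\ forall n, (n <= N)%nat -> (u n <= M * q ^ n)%R.
Proof.
intros Hq; induction N as [|N [M [HM IH]]].
- exists (Rmax 0 (u O)); split; [apply Rmax_l|]; intros n Hn.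
  replace n with O by lia; simpl; rewrite Rmult_1_r; apply Rmax_r.
- exists (Rmax M (u (S N) / q ^ S N)); split; [eapply Rle_trans; [exact HM | apply Rmax_l]|].
  intros n Hn; pose proof (pow_lt q n Hq) as P.
  destruct (Nat.eq_dec n (S N)) as [->|Hne].
  + apply Rle_trans with (u (S N) / q ^ S N * q ^ S N)%R; [right; field; lra|].
    apply Rmult_le_compat_r; [lra | apply Rmax_r].
  + apply Rle_trans with (M * q ^ n)%R; [apply IH; lia|].
    apply Rmult_le_compat_r; [lra | apply Rmax_l].
Qed.

Lemma two_step_geometric_bound (u : nat -> R) (q : R) (N : nat) :
  (0 < q)%R -> (forall n, (N <= n)%nat -> (u (S (S n)) <= q ^ 2 * u n)%R) ->
  exists M : R, forall n, (u n <= M * q ^ n)%R.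
Proof.
intros Hq Hu; destruct (prefix_geometric_bound u q (S N) Hq) as [M [_ HM]].
exists M.
(* The recurrence links indices two apart, so the induction carries two consecutive ones. *)
assert (K : forall k, (u (N + k)%nat <= M * q ^ (N + k))%R /\ (u (S (N + k)) <= M * q ^ (S (N + k)))%R).
{ induction k as [|k [IH1 IH2]].
  - split; apply HM; lia.
  - rewrite Nat.add_succ_r; split; [exact IH2|].
    eapply Rle_trans; [apply Hu; lia|].
    replace (M * q ^ S (S (N + k)))%R with (q ^ 2 * (M * q ^ (N + k)))%R by (simpl; ring).
    apply Rmult_le_compat_l; [apply pow2_ge_0 | exact IH1]. }
intros n; destruct (Nat.le_gt_cases n N) as [L|L]; [apply HM; lia|].
replace n with (N + (n - N))%nat by lia; apply K.
Qed.

(** The factor between terms two apart tends to [- t^2 / 4], so any [q > |t| / 2] works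
    eventually. *)
Lemma Cmod_E_term_rec (lambda x : R) (t : C) (q : R) :
  (Cmod t / 2 < q)%R ->
  exists N, forall n, (N <= n)%nat ->
    (Cmod (E_term lambda x t (S (S n))) <= q ^ 2 * Cmod (E_term lambda x t n))%R.
Proof.
intros Hq; pose proof (Cmod_ge_0 t) as T.
set (a := lambda + Ci * x); pose proof (Cmod_ge_0 a) as Ha.
assert (Hd : (0 < q ^ 2 - Cmod t ^ 2 / 4)%R) by nra.
(* From this index on, the contribution [|t|^2 |a|^2] is absorbed by the gap [q^2 - |t|^2 / 4] times
   [n]. *)
destruct (INR_unbounded (Cmod t ^ 2 * Cmod a ^ 2 / (q ^ 2 - Cmod t ^ 2 / 4))) as [N HN].
exists N; intros n Hn; apply le_INR in Hn.
pose proof (f_equal Cmod (E_term_rec lambda x t n)) as E.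
unfold CPS_derive in E; rewrite !Cmod_mult, Cmod_pow in E; fold a in E.
rewrite !Cmod_R, !Rabs_right in E by (apply Rle_ge, pos_INR).
pose proof (pos_INR n) as P; rewrite !S_INR in E.
set (U := Cmod (E_term lambda x t (S (S n)))) in *.
set (V := Cmod (E_term lambda x t n)) in *.
assert (HV : (0 <= V)%R) by apply Cmod_ge_0.
set (m := INR n) in *.
assert (Hz : (Cmod (a ^ 2 - (m + 1) ^ 2 / 4) <= Cmod a ^ 2 + (m + 1) ^ 2 / 4)%R).
{ eapply Rle_trans; [apply Cmod_triangle|].
  rewrite Cmod_opp, Cmod_pow; apply Rplus_le_compat_l; right.
  replace ((m + 1) ^ 2 / 4) with (RtoC ((m + 1) ^ 2 / 4)%R).
  - rewrite Cmod_R; apply Rabs_right; nra.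
  - unfold Rdiv; rewrite RtoC_mult, RtoC_inv, RtoC_pow, RtoC_plus by lra; reflexivity. }
assert (HA : (Cmod t ^ 2 * Cmod a ^ 2 <= (q ^ 2 - Cmod t ^ 2 / 4) * m)%R).
{ apply Rle_trans with ((q ^ 2 - Cmod t ^ 2 / 4) *
    (Cmod t ^ 2 * Cmod a ^ 2 / (q ^ 2 - Cmod t ^ 2 / 4)))%R; [right; field; lra|].
  apply Rmult_le_compat_l; lra. }
apply (Rmult_le_reg_l ((m + 1) * (m + 1 + 1))); [nra|].
replace ((m + 1) * (m + 1 + 1) * U)%R with ((m + 1) * ((m + 1 + 1) * U))%R by ring.
rewrite E.
replace ((m + 1) * (m + 1 + 1) * (q ^ 2 * V))%R with ((m + 1) * (m + 1 + 1) * q ^ 2 * V)%R by ring.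
apply Rmult_le_compat_r; [exact HV|].
apply Rle_trans with (Cmod t ^ 2 * (Cmod a ^ 2 + (m + 1) ^ 2 / 4))%R.
- apply Rmult_le_compat_l; [apply pow2_ge_0 | exact Hz].
- set (d := (q ^ 2 - Cmod t ^ 2 / 4)%R) in *.
  replace (q ^ 2)%R with (d + Cmod t ^ 2 / 4)%R by (unfold d; ring).
  assert (0 <= Cmod t ^ 2)%R by apply pow2_ge_0.
  nra.
Qed.

Lemma E_converges_disk (lambda x : R) (t : C) : (Cmod t < 2)%R -> E_converges lambda x t.
Proof.
intros Ht; pose proof (Cmod_ge_0 t) as T.
(* The midpoint of [|t| / 2] and 1, the ratio of the dominating geometric series. *)
set (q := ((Cmod t / 2 + 1) / 2)%R).
assert (Hq : (Cmod t / 2 < q < 1)%R) by (unfold q; lra).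
destruct (Cmod_E_term_rec lambda x t q (proj1 Hq)) as [N HN].
destruct (two_step_geometric_bound (fun n => Cmod (E_term lambda x t n)) q N) as [M HM];
  [lra | exact HN |].
apply (ex_series_le (K := C_AbsRing) (V := C_CompleteNormedModule) _ (fun n => M * q ^ n)%R).
- intros n; eapply Rle_trans, (HM n); right; unfold E_term.
  rewrite (Cmult_comm (E_coef lambda x n)), <- (pow_n_Cpow t n); reflexivity.
- apply (ex_series_scal_l (V := R_NormedModule) M (fun n => q ^ n)%R), ex_series_geom; rewrite Rabs_right; lra.
Qed.

(** * Normalization and conclusion *)

(** Its product with the root is an exponential; this makes the normalizing factor exist. *)
Lemma E_sum_0_neq_0 (lambda : R) (t : C) : E_converges lambda 0 t -> E_sum lambda 0 t <> 0.
Proof.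
intros H E; pose proof (E_sum_eq lambda 0 t H (E_converges_slit lambda t H)) as K.
rewrite E, Cmult_0_r in K; exact (Cexp_neq_0 _ (eq_sym K)).
Qed.

Theorem mainTheorem1 (lambda : R) (hlambda : (0 < lambda)%R) :
  (forall (x : R) (t : C), (Cmod t < 2)%R -> E_converges lambda x t) /\
  (exists g : C -> C, normalizing lambda g) /\
  (forall g : C -> C, normalizing lambda g ->
   forall (x : R) (t : C),
     E_converges lambda 0 t -> E_converges lambda x t ->
     E lambda g x t = Cpower (t / 2 + Csqrt (1 + t ^ 2 / 4)) (2 * Ci * x) /\
     Cpower (t / 2 + Csqrt (1 + t ^ 2 / 4)) (2 * Ci * x)
       = Cexp (2 * Ci * x * Carcsinh (t / 2))).
Proof.
split; [intros x t; apply E_converges_disk|].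
split.
- exists (fun t => / E_sum lambda 0 t); intros t H; apply Cinv_l, E_sum_0_neq_0, H.
- intros g Hg x t H0 Hx.
  split.
  + pose proof (E_converges_slit lambda t H0) as S.
    pose proof (E_sum_eq lambda 0 t H0 S) as E0; pose proof (E_sum_eq lambda x t Hx S) as Ex.
    specialize (Hg t H0); unfold E in *.
    change (g t * E_sum lambda x t = Cexp (2 * Ci * x * Clog (exp_branch t))).
    (* The factor that depends on [lambda] is the value at [x = 0], which the normalization
       cancels. *)
    assert (Es : Cexp (2 * (lambda + Ci * x) * Clog (exp_branch t)) =
      Cexp (2 * (lambda + Ci * 0) * Clog (exp_branch t)) * Cexp (2 * Ci * x * Clog (exp_branch t))).
    { rewrite <- Cexp_plus; f_equal; ring. }
    apply (Cmult_eq_reg_l (root_branch t)); [|apply Re_pos_neq_0, root_branch_Re_pos, S].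
    transitivity (g t * (root_branch t * E_sum lambda x t)); [ring|].
    rewrite Ex, Es, <- E0.
    transitivity (g t * E_sum lambda 0 t * root_branch t * Cexp (2 * Ci * x * Clog (exp_branch t))); [ring|].
    rewrite Hg; ring.
  + unfold Cpower, Carcsinh.
    replace (1 + t / 2 * (t / 2)) with (1 + t ^ 2 / 4) by field.
    reflexivity.
Qed.
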